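(* Let $C:\mathbb{R}^N\to\mathbb{R}$ be locally Lipschitz, $w^*\in\mathbb{R}^N$, and suppose there exist $0<\delta\le\mu$ and $R\in(0,1)$ such that (1) $\Vert\nabla C(w)\Vert\le\mu\Vert w-w^*\Vert$, and (2) $\langle\nabla C(w),w-w^*\rangle\ge\delta\Vert w-w^*\Vert^2$, whenever $w\in B(w^*,R)$ and $C$ is differentiable at $w$. Let $A>\mu$ with $A\ge 1$ (if $\mu<1$, take $A=1$). Let $\varepsilon>0$, $\alpha>0$, $\beta_1,\beta_2\in[0,1)$ be such that (a) $\displaystyle\frac{\delta\sqrt{\varepsilon}}{2\mu^2}<\alpha\le\frac{\delta\sqrt{\varepsilon}}{2\mu^2}\left(1+\frac{\delta}{4A}\right)$, and (b) $\displaystyle\beta_1=1-\frac{\delta\sqrt{\varepsilon}}{2\alpha\mu^2}$. Let $x^*=(0,0,w^* )$. Then there exists a neighborhood $U$ of $x^*$ in $X$ such that for every $x_0\in U$ the Adam sequence $(x_n)_n$ started at $x_0$ converges exponentially to $x^*$; that is, there exist $n_0\in\mathbb{N}$, $K>0$ and $L\in(0,1)$ such that, if $x_0\in U$, then $$\max\{\Vert m_n\Vert,\Vert v_n\Vert,A\Vert w_n-w^*\Vert\}\le K L^{n-n_0}\max\{\Vert m_0\Vert,\Vert v_0\Vert,A\Vert w_0-w^*\Vert\}\quad\text{for every } n\ge n_0 .$$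
   Context: $\Vert\cdot\Vert$ is the Euclidean norm on $\mathbb{R}^N$ and $B(w^*,R)$ the open Euclidean ball. For a locally Lipschitz $C:\mathbb{R}^N\to\mathbb{R}$, Clarke's generalized gradient at $w$ is the nonempty compact convex set $\partial_C C(w)=\mathrm{co}\{\lim_k\nabla C(w_k): w_k\to w,\ C \text{ differentiable at } w_k,\ \text{the limit exists}\}$, and $\zeta_w$ denotes the (unique) point of $\partial_C C(w)$ nearest to the origin. Let $X=\mathbb{R}^N\times[0,+\infty)^N\times\mathbb{R}^N$. Adam algorithm with parameters $\varepsilon>0$, $\beta_1,\beta_2\in[0,1)$, $\alpha>0$, started at $x_0=(m_0,v_0,w_0)\in X$: the sequence $x_n=(m_n,v_n,w_n)\in X$ defined for $n\ge0$ by $$m_{n+1}=\beta_1m_n+(1-\beta_1)\zeta_{w_n},\quad v_{n+1}=\beta_2v_n+(1-\beta_2)\zeta_{w_n}^2,\quad w_{n+1}=w_n-\alpha\frac{\sqrt{1-\beta_2^{n+1}}}{1-\beta_1^{n+1}}\,\frac{m_{n+1}}{\sqrt{v_{n+1}+(\varepsilon,\dots,\varepsilon)}},$$ where the vector square, square root, product and division are component-wise. *)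

(* Defs.v *)
From HB Require Import structures.
From mathcomp Require Import all_boot all_order all_algebra.
From mathcomp Require Import all_classical all_reals all_analysis.

Set Implicit Arguments.
Unset Strict Implicit.
Unset Printing Implicit Defensive.

Import Order.TTheory GRing.Theory Num.Theory.
Import numFieldNormedType.Exports.
Local Open Scope classical_set_scope.
Local Open Scope ring_scope.

Definition dotp (R : realType) (N : nat) (u v : 'rV[R]_N) : R :=
  \sum_(i < N) u 0 i * v 0 i.

(* The library norm [`|u|] on ['rV[R]_N] is the sup norm. Being equivalent to
   the Euclidean norm, it yields the same neighbourhoods, limits, differentials
   and locally Lipschitz functions. *)
Definition enorm (R : realType) (N : nat) (u : 'rV[R]_N) : R :=
  Num.sqrt (dotp u u).

Definition eball (R : realType) (N : nat) (c : 'rV[R]_N) (r : R) :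
  set 'rV[R]_N := [set w | enorm (w - c) < r].

Definition locally_lipschitz (R : realType) (N : nat)
    (C : 'rV[R]_N -> R) : Prop :=
  forall w : 'rV[R]_N, exists2 V : set 'rV[R]_N, nbhs w V & [lipschitz C x | x in V].

(* Only meaningful where [C] is differentiable. *)
Definition grad (R : realType) (N : nat) (C : 'rV[R]_N -> R) (w : 'rV[R]_N) :
  'rV[R]_N := \row_(i < N) 'D_(delta_mx 0 i) C w.

Definition conv_hull (R : realType) (E : lmodType R) (S : set E) : set E :=
  smallest (fun A : set E => convex_set (A : set (convex_lmodType E))) S.

Definition limiting_grad (R : realType) (N : nat) (C : 'rV[R]_N -> R)
    (w : 'rV[R]_N) : set 'rV[R]_N :=
  [set g | exists u : nat -> 'rV[R]_N,
     [/\ u @ \oo --> w,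
         forall k, differentiable C (u k)
       & (fun k => grad C (u k)) @ \oo --> g]].

Definition clarke_grad (R : realType) (N : nat) (C : 'rV[R]_N -> R)
    (w : 'rV[R]_N) : set 'rV[R]_N :=
  conv_hull (limiting_grad C w).

Definition nearest_origin (R : realType) (N : nat) (S : set 'rV[R]_N)
    (z : 'rV[R]_N) : Prop :=
  S z /\ forall y, S y -> enorm z <= enorm y.

(* States are triples (m, v, w); [adam_dom] is the phase space
   R^N x [0, +oo[^N x R^N. *)
Notation state R N := ('rV[R]_N * 'rV[R]_N * 'rV[R]_N)%type.

Definition adam_dom (R : realType) (N : nat) : set (state R N) :=
  [set x : state R N | forall i, 0 <= x.1.2 0 i].

(* [zeta w] stands for the subgradient of the objective used at [w]. *)
Section Adam.
Variables (R : realType) (N : nat) (zeta : 'rV[R]_N -> 'rV[R]_N).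
Variables (eps alpha beta1 beta2 : R).

(* The step from the n-th to the (n+1)-st iterate. *)
Definition adam_step (n : nat) (x : state R N) : state R N :=
  let: (m, v, w) := x in
  let m' := beta1 *: m + (1 - beta1) *: zeta w in
  let v' := beta2 *: v + (1 - beta2) *: \row_(i < N) (zeta w 0 i) ^+ 2 in
  let w' := w - (alpha * (Num.sqrt (1 - beta2 ^+ n.+1) / (1 - beta1 ^+ n.+1)))
                  *: \row_(i < N) (m' 0 i / Num.sqrt (v' 0 i + eps)) in
  (m', v', w').

Fixpoint adam (x0 : state R N) (n : nat) : state R N :=
  if n is k.+1 then adam_step k (adam x0 k) else x0.

End Adam.

(* max {||m||, ||v||, A ||w - wstar||} *)
Definition wmax_dist (R : realType) (N : nat) (A : R) (wstar : 'rV[R]_N)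
    (x : state R N) : R :=
  let: (m, v, w) := x in
  Num.max (enorm m) (Num.max (enorm v) (A * enorm (w - wstar))).

(* Main.v *)
(** The bounds on the gradient pass to limits and to convex hulls, hence to
    [zeta w]. Near the limit point and for large [n], the effective step
    [alpha_n / sqrt (v + eps)] is close to [alpha / sqrt eps], so an Adam step
    is a small perturbation of
      [w' - w* = (w - w* - eta zeta) - (alpha beta1 / sqrt eps) m],
    where [eta = alpha (1 - beta1) / sqrt eps = delta / (2 mu^2)]. Writing
    [Q = (delta / mu)^2], the gradient step contracts by [1 - 3 Q / 8], the
    momentum term adds at most [Q / (8 A) |m|], and the perturbation at most as
    much again, so the weighted maximum norm decreases geometrically. The
    finitely many earlier steps expand it by a bounded factor, which is absorbed
    by shrinking the initial neighbourhood. *)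
Require Import Defs.
From HB Require Import structures.
From mathcomp Require Import all_boot all_order all_algebra.
From mathcomp Require Import all_classical all_reals all_analysis.
From mathcomp Require Import ring lra.

Set Implicit Arguments.
Unset Strict Implicit.
Unset Printing Implicit Defensive.

Import Order.TTheory GRing.Theory Num.Theory.
Import numFieldNormedType.Exports.
Local Open Scope classical_set_scope.
Local Open Scope ring_scope.

(** * Euclidean inner product and norm *)

Section EuclideanNorm.
Context {R : realType} {N : nat}.
Implicit Types u v w : 'rV[R]_N.

Lemma dotpC u v : dotp u v = dotp v u.
Proof. by apply: eq_bigr => i _; rewrite mulrC. Qed.

Lemma dotpDl u v w : dotp (u + v) w = dotp u w + dotp v w.
Proof. by rewrite -big_split; apply: eq_bigr => i _; rewrite mxE mulrDl. Qed.

Lemma dotpZl (a : R) u v : dotp (a *: u) v = a * dotp u v.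
Proof. by rewrite mulr_sumr; apply: eq_bigr => i _; rewrite mxE mulrA. Qed.

Lemma dotpDr u v w : dotp u (v + w) = dotp u v + dotp u w.
Proof. by rewrite dotpC dotpDl !(dotpC u). Qed.

Lemma dotpZr (a : R) u v : dotp u (a *: v) = a * dotp u v.
Proof. by rewrite dotpC dotpZl dotpC. Qed.

Lemma dotp_ge0 u : 0 <= dotp u u.
Proof. by apply: sumr_ge0 => i _; rewrite -expr2 sqr_ge0. Qed.

Lemma enorm_ge0 u : 0 <= enorm u.
Proof. exact: sqrtr_ge0. Qed.

Lemma enorm_sqr u : enorm u ^+ 2 = dotp u u.
Proof. by rewrite sqr_sqrtr// dotp_ge0. Qed.

Lemma enorm0 : enorm (0 : 'rV[R]_N) = 0.
Proof. by rewrite /enorm /dotp big1 ?sqrtr0// => i _; rewrite mxE mul0r. Qed.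

Lemma enormZ (a : R) u : enorm (a *: u) = `|a| * enorm u.
Proof. by rewrite /enorm dotpZl dotpZr mulrA -expr2 sqrtrM ?sqr_ge0// sqrtr_sqr. Qed.

Lemma enormN u : enorm (- u) = enorm u.
Proof. by rewrite -scaleN1r enormZ normrN1 mul1r. Qed.

Lemma enorm_le_sqr u (b : R) : 0 <= b -> (enorm u <= b) = (dotp u u <= b ^+ 2).
Proof. by move=> b0; rewrite -enorm_sqr ler_sqr ?nnegrE ?enorm_ge0. Qed.

Lemma enorm_eq0 u : enorm u = 0 -> u = 0.
Proof.
move=> u0; have /eqP : dotp u u = 0 by rewrite -enorm_sqr u0 expr0n.
rewrite psumr_eq0 => [/allP us|i _]; last by rewrite -expr2 sqr_ge0.
apply/rowP => i; rewrite mxE; apply/eqP.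
by have := us i (mem_index_enum _); rewrite -expr2 sqrf_eq0.
Qed.

Lemma dotp0l v : dotp 0 v = 0.
Proof. by rewrite -(scale0r (0 : 'rV[R]_N)) dotpZl mul0r. Qed.

(** The squared norm of [|v| u - |u| v] is nonnegative; expand it and cancel [|u| |v|], the zero
    cases being treated apart. *)
Lemma cauchy_schwarz u v : dotp u v <= enorm u * enorm v.
Proof.
have [/enorm_eq0 ->|u0] := eqVneq (enorm u) 0.
  by rewrite dotp0l enorm0 mul0r.
have [/enorm_eq0 ->|v0] := eqVneq (enorm v) 0.
  by rewrite dotpC dotp0l enorm0 mulr0.
have {}u0 : 0 < enorm u by rewrite lt_neqAle eq_sym u0 enorm_ge0.
have {}v0 : 0 < enorm v by rewrite lt_neqAle eq_sym v0 enorm_ge0.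
have := dotp_ge0 (enorm v *: u + (- enorm u) *: v).
rewrite !dotpDl !dotpDr !dotpZl !dotpZr -!enorm_sqr (dotpC v u) => h.
rewrite -(ler_pM2l (mulr_gt0 u0 v0)); lra.
Qed.

Lemma enormD u v : enorm (u + v) <= enorm u + enorm v.
Proof.
rewrite enorm_le_sqr ?addr_ge0 ?enorm_ge0//.
rewrite dotpDl !dotpDr (dotpC v u) -!enorm_sqr.
have := cauchy_schwarz u v; lra.
Qed.

(** Serves for componentwise products: factors bounded by [b] in absolute value cost at most [b] in
    the Euclidean norm. *)
Lemma enorm_scaled_le u v (b : R) : 0 <= b ->
  (forall i, `|u 0 i| <= b * `|v 0 i|) -> enorm u <= b * enorm v.
Proof.
move=> b0 uv; rewrite enorm_le_sqr ?mulr_ge0 ?enorm_ge0//.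
rewrite exprMn enorm_sqr mulr_sumr; apply: ler_sum => i _.
rewrite -!expr2 -(real_normK (num_real (u 0 i))) -(real_normK (num_real (v 0 i))).
by rewrite -exprMn ler_sqr ?nnegrE ?mulr_ge0.
Qed.

Lemma coord_le_enorm u i : `|u 0 i| <= enorm u.
Proof.
rewrite -ler_sqr ?nnegrE ?enorm_ge0// enorm_sqr real_normK ?num_real//.
rewrite /dotp (bigD1 i)//= -expr2 lerDl sumr_ge0// => j _.
by rewrite -expr2 sqr_ge0.
Qed.

Lemma enorm_sqr_coord u :
  enorm (\row_(i < N) (u 0 i) ^+ 2) <= enorm u ^+ 2.
Proof.
rewrite expr2; apply: enorm_scaled_le (enorm_ge0 u) _ => i.
by rewrite mxE normrX expr2 ler_wpM2r// coord_le_enorm.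
Qed.

Lemma dotp_cvg (T : Type) (F : set_system T) {FF : Filter F}
    (f g : T -> 'rV[R]_N) u v :
  f @ F --> u -> g @ F --> v -> dotp (f x) (g x) @[x --> F] --> dotp u v.
Proof.
move=> fu gv; rewrite /dotp; apply: cvg_big => [|i _].
- exact: add_continuous.
- apply: cvgM.
    by apply: (continuous_cvg (h := fun w : 'rV[R]_N => w 0 i) _ _ fu);
      exact: coord_continuous.
  by apply: (continuous_cvg (h := fun w : 'rV[R]_N => w 0 i) _ _ gv);
      exact: coord_continuous.
Qed.

Lemma enorm_cvg (T : Type) (F : set_system T) {FF : Filter F}
    (f : T -> 'rV[R]_N) u :
  f @ F --> u -> enorm (f x) @[x --> F] --> enorm u.
Proof.
move=> fu; apply: (@continuous_cvg _ _ _ F FF (fun x => dotp (f x) (f x)) Num.sqrt).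
  exact: sqrt_continuous.
exact: (dotp_cvg fu fu).
Qed.

End EuclideanNorm.

(** * Gradient bounds carried over to the Clarke gradient *)

Section ClarkeGradient.
Context {R : realType} {N : nat}.
Variables (C : 'rV[R]_N -> R) (c : 'rV[R]_N) (r : R).

(** The hull is the smallest convex set containing the limiting gradients, so a convex property need
    only be checked on these. *)
Lemma clarke_grad_convex (P : 'rV[R]_N -> Prop) w :
  (forall x y (t : R), 0 <= t -> t <= 1 -> P x -> P y ->
     P (t *: x + (1 - t) *: y)) ->
  limiting_grad C w `<=` P -> clarke_grad C w `<=` P.
Proof.
move=> cP; apply: smallest_sub => x y t /set_mem Px /set_mem Py.
by apply/mem_set; apply: cP.
Qed.

(** A norm bound on [g] is convex and survives limits; the ball being open, a sequence tending to
    [w] eventually lies in it. *)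
Lemma clarke_grad_le (mu : R) w g :
  (forall w, eball c r w -> differentiable C w ->
     enorm (grad C w) <= mu * enorm (w - c)) ->
  eball c r w -> clarke_grad C w g -> enorm g <= mu * enorm (w - c).
Proof.
move=> hC wr; move: g; apply: clarke_grad_convex.
  move=> x y t t0 t1 xm ym; apply: le_trans (enormD _ _) _.
  rewrite !enormZ !ger0_norm ?subr_ge0//.
  have := ler_wpM2l t0 xm; have t1' : 0 <= 1 - t by rewrite subr_ge0.
  have := ler_wpM2l t1' ym; lra.
move=> g [u [uw du ug]].
have uc : (fun k => u k - c) @ \oo --> w - c by apply: cvgB => //; exact: cvg_cst.
apply: (ler_cvg_to (enorm_cvg ug)).
  by apply: cvgM (enorm_cvg uc); exact: cvg_cst.
near=> k; apply: hC => //.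
near: k; apply: (cvgr_lt _ (enorm_cvg uc)); exact: wr.
Unshelve. all: by end_near. Qed.

(** For fixed [w] the condition cuts out a half-space of vectors [g], hence is convex, and both
    sides pass to the limit. *)
Lemma clarke_grad_dotp_ge (delta : R) w g :
  (forall w, eball c r w -> differentiable C w ->
     delta * enorm (w - c) ^+ 2 <= dotp (grad C w) (w - c)) ->
  eball c r w -> clarke_grad C w g ->
  delta * enorm (w - c) ^+ 2 <= dotp g (w - c).
Proof.
move=> hC wr; move: g; apply: clarke_grad_convex.
  move=> x y t t0 t1 xm ym.
  rewrite dotpDl !dotpZl.
  have := ler_wpM2l t0 xm; have t1' : 0 <= 1 - t by rewrite subr_ge0.
  have := ler_wpM2l t1' ym; lra.
move=> g [u [uw du ug]].
have uc : (fun k => u k - c) @ \oo --> w - c by apply: cvgB => //; exact: cvg_cst.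
have en : enorm (u k - c) @[k --> \oo] --> enorm (w - c) by exact: enorm_cvg uc.
apply: (ler_cvg_to (f := fun k => delta * enorm (u k - c) ^+ 2) _ (dotp_cvg ug uc)).
  apply: cvgM; first exact: cvg_cst.
  by apply: (continuous_cvg (h := fun x : R => x ^+ 2) _ _ en); exact: exprn_continuous.
near=> k; apply: hC => //.
near: k; apply: (cvgr_lt _ en); exact: wr.
Unshelve. all: by end_near. Qed.

End ClarkeGradient.

(** * One-step estimates for the moments and the position *)

Section StepEstimates.
Context {R : realType} {N : nat}.
Variables (delta mu A alpha s beta : R).
Hypotheses (delta_gt0 : 0 < delta) (delta_le_mu : delta <= mu).
Hypotheses (mu_lt_A : mu < A).
Hypotheses (s_gt0 : 0 < s) (alpha_gt0 : 0 < alpha) (beta_ge0 : 0 <= beta).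
Hypothesis alpha_le : alpha <= delta * s / (2 * mu ^+ 2) * (1 + delta / (4 * A)).
Hypothesis betaE : beta = 1 - delta * s / (2 * alpha * mu ^+ 2).
Implicit Types e z m : 'rV[R]_N.

Let mu_gt0 : 0 < mu. Proof. exact: lt_le_trans delta_le_mu. Qed.
Let A_gt0 : 0 < A. Proof. exact: lt_trans mu_lt_A. Qed.

(** Half the minimiser [delta / mu ^+ 2] of [1 - 2 t delta + t^2 mu^2], the factor bounding the
    squared norm after a gradient step of size [t]. *)
Let eta := delta / (2 * mu ^+ 2).
Let Q := (delta / mu) ^+ 2.

Let etaE : eta * delta = Q / 2.
Proof. by rewrite /eta /Q; field; rewrite gt_eqF. Qed.

Let eta_mu : eta ^+ 2 * mu ^+ 2 = Q / 4.
Proof. by rewrite /eta /Q; field; rewrite gt_eqF. Qed.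

Let Q_le1 : Q <= 1.
Proof.
have q0 : 0 <= delta / mu by rewrite divr_ge0 ?ltW.
by rewrite expr_le1// ler_pdivrMr// mul1r.
Qed.

(** Expanding the square and using [etaE] and [eta_mu] leaves at most [1 - Q + Q / 4 = 1 - 3 Q / 4]
    times [enorm e ^+ 2]. *)
Lemma gradient_step_le e z :
  enorm z <= mu * enorm e -> delta * enorm e ^+ 2 <= dotp z e ->
  enorm (e - eta *: z) <= (1 - 3 / 8 * Q) * enorm e.
Proof.
move=> z_le z_ge; have Q1 := Q_le1.
have e0 := enorm_ge0 e; have z0 := enorm_ge0 z.
have eta0 : 0 <= eta by rewrite divr_ge0 ?mulr_ge0 ?sqr_ge0 ?ltW.
rewrite enorm_le_sqr; last by rewrite mulr_ge0//; lra.
rewrite -scaleNr !dotpDl !dotpDr !dotpZl !dotpZr (dotpC e z) -!enorm_sqr.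
have h1 : eta * (delta * enorm e ^+ 2) <= eta * dotp z e by rewrite ler_wpM2l.
have h2 : eta ^+ 2 * enorm z ^+ 2 <= eta ^+ 2 * (mu * enorm e) ^+ 2.
  by rewrite ler_wpM2l ?sqr_ge0// ler_sqr ?nnegrE// (le_trans z0).
rewrite mulrA etaE in h1; rewrite (exprMn _ mu) (mulrA (eta ^+ 2) (mu ^+ 2)) eta_mu in h2.
(* This square is the gap between [1 - 3 Q / 4] and [(1 - 3 Q / 8)^2], times [enorm e ^+ 2]. *)
have h3 : 0 <= (3 / 8 * Q * enorm e) ^+ 2 by rewrite sqr_ge0.
lra.
Qed.

(** The upper bound on [alpha] gives [alpha / s - eta <= eta delta / (4 A)], and
    [eta delta = Q / 2]. *)
Lemma momentum_weight_le : alpha / s * beta <= Q / 8 / A.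
Proof.
(* [beta] is chosen so that [(alpha / s) (1 - beta) = eta]. *)
have -> : alpha / s * beta = alpha / s - eta.
  by rewrite betaE /eta; field; rewrite !gt_eqF.
rewrite lerBlDl ler_pdivrMr//; apply: le_trans alpha_le _.
by rewrite le_eqVlt; apply/orP; left; apply/eqP; rewrite /eta /Q; field; rewrite !gt_eqF.
Qed.

(** The weight [A] turns [mu * enorm e] into at most [(mu / A) * M]; as [mu < A], the resulting
    factor is below 1 once [beta < 1]. *)
Lemma momentum_le e z m (M : R) : beta <= 1 ->
  enorm z <= mu * enorm e -> enorm m <= M -> A * enorm e <= M ->
  enorm (beta *: m + (1 - beta) *: z) <= (beta + (1 - beta) * (mu / A)) * M.
Proof.
move=> beta1 z_le mM eM; apply: le_trans (enormD _ _) _.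
rewrite !enormZ !ger0_norm ?subr_ge0// (mulrDl _ _ M) lerD ?ler_wpM2l//.
rewrite -mulrA ler_wpM2l ?subr_ge0//; apply: le_trans z_le _.
by rewrite -mulrA ler_pM2l// ler_pdivlMl.
Qed.

Lemma momentum_le_max e z m (M : R) : beta <= 1 ->
  enorm z <= mu * enorm e -> enorm m <= M -> A * enorm e <= M ->
  enorm (beta *: m + (1 - beta) *: z) <= M.
Proof.
move=> beta1 z_le mM eM; apply: le_trans (momentum_le beta1 z_le mM eM) _.
rewrite -[leRHS]mul1r ler_wpM2r ?(le_trans (enorm_ge0 m))//.
suff : (1 - beta) * (mu / A) <= (1 - beta) * 1 by lra.
by rewrite ler_wpM2l ?subr_ge0// ler_pdivrMr// mul1r ltW.
Qed.

(* The update is the gradient step [e - eta z], with [eta = delta / (2 mu^2)],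
   perturbed by the old momentum and by the error in the preconditioned step;
   each perturbation costs at most [Q / 8] of the gain [3 Q / 8]. *)
Lemma position_le e z m (d : 'I_N -> R) (M : R) : beta <= 1 ->
  enorm z <= mu * enorm e -> delta * enorm e ^+ 2 <= dotp z e ->
  enorm m <= M -> A * enorm e <= M ->
  (forall i, `|d i - alpha / s| <= Q / 8 / A) ->
  A * enorm (e - \row_i (d i * (beta *: m + (1 - beta) *: z) 0 i))
    <= (1 - Q / 8) * M.
Proof.
move=> beta1 z_le z_ge mM eM d_le.
set m' := beta *: m + (1 - beta) *: z.
have M0 : 0 <= M := le_trans (enorm_ge0 _) mM.
have k0 : 0 <= Q / 8 / A by rewrite !divr_ge0 ?sqr_ge0 ?ltW.
(* Split [d i] into [alpha / s] and an error; in the main part [z] has coefficient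
   [(alpha / s) (1 - beta) = eta]. *)
have -> : e - \row_i (d i * m' 0 i) =
    (e - eta *: z) - ((alpha / s * beta) *: m + \row_i ((d i - alpha / s) * m' 0 i)).
  apply/rowP => i; rewrite /m' !mxE betaE /eta; field.
  by rewrite !gt_eqF.
have h1 : enorm (e - eta *: z) <= (1 - 3 / 8 * Q) * enorm e by exact: gradient_step_le.
have h2 : enorm ((alpha / s * beta) *: m) <= Q / 8 / A * M.
  have w0 : 0 <= alpha / s * beta by rewrite mulr_ge0// divr_ge0// ltW.
  by rewrite enormZ ger0_norm// ler_pM ?enorm_ge0// momentum_weight_le.
have h3 : enorm (\row_i ((d i - alpha / s) * m' 0 i)) <= Q / 8 / A * M.
  apply: (@le_trans _ _ (Q / 8 / A * enorm m')).
    by apply: enorm_scaled_le => // i; rewrite mxE normrM ler_wpM2r.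
  by rewrite ler_wpM2l// (momentum_le_max beta1 z_le mM eM).
apply: (@le_trans _ _ (A * ((1 - 3 / 8 * Q) * enorm e + Q / 8 / A * M + Q / 8 / A * M))).
  rewrite ler_pM2l//; apply: le_trans (enormD _ _) _.
  rewrite enormN -addrA lerD//; apply: le_trans (enormD _ _) _.
  exact: lerD.
have -> : A * ((1 - 3 / 8 * Q) * enorm e + Q / 8 / A * M + Q / 8 / A * M) =
    (1 - 3 / 8 * Q) * (A * enorm e) + Q / 4 * M.
  by field; rewrite gt_eqF.
have : (1 - 3 / 8 * Q) * (A * enorm e) <= (1 - 3 / 8 * Q) * M.
  by rewrite ler_wpM2l//; have := Q_le1; lra.
lra.
Qed.

(** For the early steps, where the coefficients are only known to be bounded: the triangle
    inequality gives bounded growth instead of contraction. *)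
Lemma position_crude_le e z m (d : 'I_N -> R) (D M : R) : beta <= 1 -> 0 <= D ->
  enorm z <= mu * enorm e -> enorm m <= M -> A * enorm e <= M ->
  (forall i, `|d i| <= D) ->
  A * enorm (e - \row_i (d i * (beta *: m + (1 - beta) *: z) 0 i))
    <= (1 + A * D) * M.
Proof.
move=> beta1 D0 z_le mM eM d_le.
set m' := beta *: m + (1 - beta) *: z.
have M0 : 0 <= M := le_trans (enorm_ge0 _) mM.
apply: (@le_trans _ _ (A * (enorm e + D * M))); last lra.
rewrite ler_pM2l//; apply: le_trans (enormD _ _) _.
rewrite enormN lerD//; apply: (@le_trans _ _ (D * enorm m')).
  by apply: enorm_scaled_le => // i; rewrite mxE normrM ler_wpM2r.
by rewrite ler_wpM2l// (momentum_le_max beta1 z_le mM eM).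
Qed.

End StepEstimates.

(* Being quadratic in [z], the second moment contracts near the limit: there
   [k] may be taken small, however large [mu] is. *)
Lemma second_moment_le (R : realType) (N : nat) (v z : 'rV[R]_N)
    (beta k M : R) :
  0 <= beta -> beta <= 1 -> enorm v <= M -> enorm z ^+ 2 <= k * M ->
  enorm (beta *: v + (1 - beta) *: \row_(i < N) (z 0 i) ^+ 2)
    <= (beta + (1 - beta) * k) * M.
Proof.
move=> beta0 beta1 vM zM; apply: le_trans (enormD _ _) _.
rewrite !enormZ !ger0_norm ?subr_ge0// (mulrDl _ _ M) lerD ?ler_wpM2l//.
rewrite -mulrA ler_wpM2l ?subr_ge0//.
exact: le_trans (enorm_sqr_coord z) zM.
Qed.

(** * Bias correction and the preconditioned step size *)

Section StepSize.
Context {R : realType}.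
Variables (eps alpha beta1 beta2 : R).
Hypotheses (eps_gt0 : 0 < eps) (alpha_gt0 : 0 < alpha).
Hypotheses (beta1_ge0 : 0 <= beta1) (beta1_lt1 : beta1 < 1).
Hypotheses (beta2_ge0 : 0 <= beta2) (beta2_lt1 : beta2 < 1).

(** The bias-corrected learning rate; the exponent is [n.+1] because step [n] produces iterate
    [n.+1]. *)
Definition step_size (n : nat) : R :=
  alpha * (Num.sqrt (1 - beta2 ^+ n.+1) / (1 - beta1 ^+ n.+1)).

Lemma step_size_cvg : step_size @ \oo --> alpha.
Proof.
have bcvg (b : R) : 0 <= b -> b < 1 -> (fun n => 1 - b ^+ n.+1) @ \oo --> (1 : R).
  move=> b0 b1; rewrite -[X in _ --> X]subr0.
  apply: cvgB; first exact: cvg_cst.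
  have /cvg_expr : `|b| < 1 by rewrite ger0_norm.
  by rewrite -(cvg_shiftS (GRing.exp b)).
rewrite -[X in _ --> X]mulr1; apply: cvgM; first exact: cvg_cst.
rewrite -[X in _ --> X]divr1; apply: cvgM.
  rewrite -[X in _ --> X]sqrtr1.
  apply: (continuous_cvg (h := Num.sqrt) _ _ (bcvg _ beta2_ge0 beta2_lt1)).
  exact: sqrt_continuous.
by apply: cvgV; [exact: oner_neq0|exact: bcvg].
Qed.

Lemma step_size_bounds n : 0 <= step_size n <= alpha / (1 - beta1).
Proof.
have b1 : beta1 ^+ n.+1 <= beta1.
  by rewrite -[leRHS]expr1 ler_wiXn2l// ltW.
have /andP[b2 _] : 0 <= beta2 ^+ n.+1 <= 1 by rewrite exprn_ge0// exprn_ile1// ltW.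
have d0 : 0 < 1 - beta1 by rewrite subr_gt0.
have dn0 : 0 < 1 - beta1 ^+ n.+1 by rewrite subr_gt0 (le_lt_trans b1).
apply/andP; split.
  by rewrite mulr_ge0 ?divr_ge0 ?sqrtr_ge0 ?ltW.
rewrite ler_pM2l// ler_pdivrMr//.
apply: (@le_trans _ _ 1).
  by rewrite -[leRHS]sqrtr1 ler_sqrt//; lra.
by rewrite ler_pdivlMl// mulr1; lra.
Qed.

Lemma precond_step_bounds n (v : R) : 0 <= v ->
  `|step_size n / Num.sqrt (v + eps)| <= alpha / (1 - beta1) / Num.sqrt eps.
Proof.
move=> v0; have /andP[a0 a1] := step_size_bounds n.
have s0 : 0 < Num.sqrt eps by rewrite sqrtr_gt0.
have vs : Num.sqrt eps <= Num.sqrt (v + eps).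
  by rewrite ler_sqrt ?lerDr// addr_ge0// ltW.
have sv0 := lt_le_trans s0 vs.
rewrite ger0_norm; last by rewrite divr_ge0 ?sqrtr_ge0.
by rewrite ler_pM// ?invr_ge0 ?sqrtr_ge0// lef_pV2// posrE.
Qed.

(** The error splits into a bias-correction part, small for large [n], and a part due to [v], small
    by continuity of [1 / sqrt (v + eps)] at 0; each is allotted [k / 2]. *)
Lemma precond_step_near (k : R) : 0 < k ->
  exists (n0 : nat) (rho : R), 0 < rho /\
    forall n v, (n0 <= n)%N -> 0 <= v -> v <= rho ->
      `|step_size n / Num.sqrt (v + eps) - alpha / Num.sqrt eps| <= k.
Proof.
move=> k0; have s0 : 0 < Num.sqrt eps by rewrite sqrtr_gt0.
have gcont : {for 0, continuous (fun v : R => (Num.sqrt (v + eps))^-1)}.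
  apply: cvgV; first by rewrite add0r gt_eqF.
  have vcvg : v + eps @[v --> (0 : R)] --> 0 + eps.
    by apply: cvgD; [exact: cvg_id|exact: cvg_cst].
  by apply: (continuous_cvg (h := Num.sqrt) _ _ vcvg); exact: sqrt_continuous.
have /cvgrPdist_lt /(_ _ (divr_gt0 k0 (mulr_gt0 (ltr0Sn R 1) alpha_gt0))) := gcont.
move=> /nbhs_ballP[t /= t0 ht].
have := step_size_cvg.
move=> /cvgrPdist_lt /(_ _ (divr_gt0 (mulr_gt0 k0 s0) (ltr0Sn R 1))).
move=> [n0 _ hn0].
(* Halving the radius puts the closed range [v <= t / 2] inside the open ball. *)
exists n0, (t / 2); split; first by rewrite divr_gt0.
move=> n v nn0 v0 vt.
have {hn0} an := hn0 n nn0.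
have {ht} gv : `|(Num.sqrt eps)^-1 - (Num.sqrt (v + eps))^-1| < k / (2 * alpha).
  have := ht v; rewrite add0r; apply.
  by rewrite /ball /= sub0r normrN ger0_norm//; lra.
have vs : Num.sqrt eps <= Num.sqrt (v + eps).
  by rewrite ler_sqrt ?lerDr// addr_ge0// ltW.
have sv0 := lt_le_trans s0 vs.
have -> : step_size n / Num.sqrt (v + eps) - alpha / Num.sqrt eps =
   - ((alpha - step_size n) / Num.sqrt (v + eps)
     + alpha * ((Num.sqrt eps)^-1 - (Num.sqrt (v + eps))^-1)) by lra.
rewrite normrN; apply: le_trans (ler_normD _ _) _.
rewrite (splitr k) !normrM (gtr0_norm alpha_gt0) lerD//.
  rewrite normfV (gtr0_norm sv0) ler_pdivrMr//; apply: le_trans (ltW an) _.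
  by rewrite mulrAC ler_wpM2l// divr_ge0// ltW.
rewrite -ler_pdivlMl//; apply: le_trans (ltW gv) _.
by rewrite le_eqVlt; apply/orP; left; apply/eqP; field; rewrite gt_eqF.
Qed.

End StepSize.

(** * Geometric decay from local one-step bounds *)

(** The one-step bounds are available only below [rho]. The first [n0] steps stay there since
    [G ^+ n <= G ^+ n0], the later ones since [L <= 1]. *)
Lemma eventual_contraction (R : realType) (M : nat -> R) (G L rho : R) (n0 : nat) :
  1 <= G -> 0 <= L -> L <= 1 -> (forall n, 0 <= M n) ->
  (forall n, M n <= rho -> M n.+1 <= G * M n) ->
  (forall n, (n0 <= n)%N -> M n <= rho -> M n.+1 <= L * M n) ->
  G ^+ n0 * M 0%N <= rho ->
  forall n, (n0 <= n)%N -> M n <= G ^+ n0 * L ^+ (n - n0) * M 0%N.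
Proof.
move=> G1 L0 L1 M0 MG ML Mrho.
have G0 : 0 <= G := le_trans ler01 G1.
have grow n : (n <= n0)%N -> M n <= G ^+ n * M 0%N.
  elim: n => [|n IH] nn0; first by rewrite expr0 mul1r.
  have Mn := IH (ltnW nn0).
  apply: le_trans (MG n _) _; last by rewrite exprS -[leRHS]mulrA ler_wpM2l.
  apply: le_trans Mn _; apply: le_trans Mrho.
  by rewrite ler_wpM2r// ler_weXn2l// ltnW.
move=> n /subnKC <-; rewrite addKn; elim: (n - n0)%N => [|k IH].
  by rewrite addn0 expr0 mulr1 grow.
rewrite addnS; apply: le_trans (ML _ (leq_addr _ _) _) _.
  apply: le_trans IH _; apply: le_trans Mrho.
  by rewrite ler_wpM2r// ler_piMr ?exprn_ge0// exprn_ile1.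
by rewrite exprS (mulrCA _ L) -[leRHS]mulrA ler_wpM2l.
Qed.

(** * The weighted maximum norm along the Adam iteration *)

Lemma wmax_dist_le (R : realType) (N : nat) (A t : R) (wstar : 'rV[R]_N)
    (x : state R N) :
  (wmax_dist A wstar x <= t) =
  [&& enorm x.1.1 <= t, enorm x.1.2 <= t & A * enorm (x.2 - wstar) <= t].
Proof. by case: x => [[m v] w]; rewrite /wmax_dist !ge_max. Qed.

Lemma wmax_dist_ge0 (R : realType) (N : nat) (A : R) (wstar : 'rV[R]_N)
    (x : state R N) : 0 <= wmax_dist A wstar x.
Proof. by case: x => [[m v] w]; rewrite /wmax_dist le_max enorm_ge0. Qed.

Lemma wmax_dist_nbhs (R : realType) (N : nat) (A t : R) (wstar : 'rV[R]_N) :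
  0 < t -> \forall x \near ((0, 0, wstar) : state R N), wmax_dist A wstar x <= t.
Proof.
move=> t0.
have hm : enorm x.1.1 @[x --> ((0, 0, wstar) : state R N)] --> enorm (0 : 'rV[R]_N).
  apply: enorm_cvg; apply: (cvg_comp fst fst); exact: cvg_fst.
have hv : enorm x.1.2 @[x --> ((0, 0, wstar) : state R N)] --> enorm (0 : 'rV[R]_N).
  apply: enorm_cvg; apply: (cvg_comp fst snd); [exact: cvg_fst|exact: cvg_snd].
have hw : A * enorm (x.2 - wstar) @[x --> ((0, 0, wstar) : state R N)] -->
    A * enorm (wstar - wstar).
  apply: cvgM; first exact: cvg_cst.
  by apply: enorm_cvg; apply: cvgB; [exact: cvg_snd|exact: cvg_cst].
rewrite enorm0 in hm hv; rewrite subrr enorm0 mulr0 in hw.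
near=> x.
rewrite wmax_dist_le; apply/and3P; split; near: x.
- by apply: (cvgr_le _ hm).
- by apply: (cvgr_le _ hv).
- by apply: (cvgr_le _ hw).
Unshelve. all: by end_near. Qed.

(** Keeps [sqrt (v + eps)] at least [sqrt eps] along the orbit, as the step-size bounds require. *)
Lemma adam_dom_adam (R : realType) (N : nat) (zeta : 'rV[R]_N -> 'rV[R]_N)
    (eps alpha beta1 beta2 : R) (x0 : state R N) n :
  0 <= beta2 -> beta2 <= 1 -> adam_dom x0 ->
  adam_dom (adam zeta eps alpha beta1 beta2 x0 n).
Proof.
move=> b0 b1 x0d; elim: n => //= n.
case: (adam _ _ _ _ _ _ n) => [[m v] w] vd i; rewrite /= !mxE.
by rewrite addr_ge0// mulr_ge0 ?sqr_ge0 ?subr_ge0//; exact: vd.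
Qed.

(** Brings the update to the form treated in [position_le], with coefficients taken at the updated
    second moment. *)
Lemma adam_step_wE (R : realType) (N : nat) (zeta : 'rV[R]_N -> 'rV[R]_N)
    (eps alpha beta1 beta2 : R) n (m v w wstar : 'rV[R]_N) :
  let x' := adam_step zeta eps alpha beta1 beta2 n (m, v, w) in
  x'.2 - wstar = (w - wstar) - \row_i
    (step_size alpha beta1 beta2 n / Num.sqrt (x'.1.2 0 i + eps) * x'.1.1 0 i).
Proof.
rewrite /= addrAC; congr (_ - _); apply/rowP => i.
by rewrite !mxE /step_size; lra.
Qed.

(** * Choice of constants and exponential convergence *)

Theorem theorem2p11 (R : realType) (N : nat) (C : 'rV[R]_N -> R)
    (zeta : 'rV[R]_N -> 'rV[R]_N) (wstar : 'rV[R]_N)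
    (delta mu r A eps alpha beta1 beta2 : R)
    (C_lip : locally_lipschitz C)
    (zeta_nearest : forall w, nearest_origin (clarke_grad C w) (zeta w))
    (delta_gt0 : 0 < delta) (delta_le_mu : delta <= mu)
    (r_gt0 : 0 < r) (r_lt1 : r < 1)
    (grad_le : forall w, eball wstar r w -> differentiable C w ->
       enorm (grad C w) <= mu * enorm (w - wstar))
    (grad_ge : forall w, eball wstar r w -> differentiable C w ->
       delta * enorm (w - wstar) ^+ 2 <= dotp (grad C w) (w - wstar))
    (mu_lt_A : mu < A) (A_ge1 : 1 <= A)
    (eps_gt0 : 0 < eps) (alpha_gt0 : 0 < alpha)
    (beta1_ge0 : 0 <= beta1) (beta1_lt1 : beta1 < 1)
    (beta2_ge0 : 0 <= beta2) (beta2_lt1 : beta2 < 1)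
    (alpha_gt : delta * Num.sqrt eps / (2 * mu ^+ 2) < alpha)
    (alpha_le : alpha <= delta * Num.sqrt eps / (2 * mu ^+ 2) *
                           (1 + delta / (4 * A)))
    (beta1E : beta1 = 1 - delta * Num.sqrt eps / (2 * alpha * mu ^+ 2)) :
  exists U : set (state R N),
    [/\ U `<=` @adam_dom R N,
        within (@adam_dom R N) (nbhs ((0, 0, wstar) : state R N)) U
      & exists (n0 : nat) (K L : R),
          [/\ 0 < K, 0 < L, L < 1
            & forall x0, U x0 -> forall n, (n0 <= n)%N ->
                wmax_dist A wstar (adam zeta eps alpha beta1 beta2 x0 n) <=
                K * L ^+ (n - n0) * wmax_dist A wstar x0]].
Proof.
have mu_gt0 : 0 < mu := lt_le_trans delta_gt0 delta_le_mu.
have A_gt0 : 0 < A := lt_le_trans ltr01 A_ge1.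
set s := Num.sqrt eps in alpha_gt alpha_le beta1E.
have s_gt0 : 0 < s by rewrite sqrtr_gt0.
set Q := (delta / mu) ^+ 2.
have Q_gt0 : 0 < Q by rewrite exprn_gt0// divr_gt0.
have Q_le1 : Q <= 1.
  have q0 : 0 <= delta / mu by rewrite divr_ge0 ?ltW.
  by rewrite expr_le1// ler_pdivrMr// mul1r.
have k_gt0 : 0 < Q / 8 / A by rewrite !divr_gt0.
have [n0 [rho1 [rho1_gt0 step_near]]] := precond_step_near
  eps_gt0 alpha_gt0 beta1_ge0 beta1_lt1 beta2_ge0 beta2_lt1 k_gt0.
set D := alpha / (1 - beta1) / s.
have D_ge0 : 0 <= D by rewrite !divr_ge0 ?subr_ge0 ?ltW.
(* The three bounds keep [w] in the ball, keep the preconditioned step near [alpha / s], and make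
   [enorm (zeta w) ^+ 2] at most half the weighted norm. *)
pose rho := Num.min (Num.min (r / 2) rho1) (2 * mu ^+ 2)^-1.
have rho_gt0 : 0 < rho.
  by rewrite !lt_min rho1_gt0 divr_gt0//= invr_gt0 mulr_gt0// exprn_gt0.
have [rho_r rho_rho1 rho_mu] : [/\ rho < r, rho <= rho1 & mu ^+ 2 * rho <= 2^-1].
  split; first by rewrite !gt_min ltr_pdivrMr// ltr_pMr// ltr1n.
  - by rewrite !ge_min lexx orbT.
  - have -> : (2^-1 : R) = mu ^+ 2 * (2 * mu ^+ 2)^-1 by field; rewrite gt_eqF.
    by rewrite ler_pM2l ?exprn_gt0// ge_min lexx orbT.
have wm_lt1 : beta1 + (1 - beta1) * (mu / A) < 1.
  suff : (1 - beta1) * (mu / A) < (1 - beta1) * 1 by lra.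
  by rewrite ltr_pM2l ?subr_gt0// ltr_pdivrMr// mul1r.
have wv_lt1 : beta2 + (1 - beta2) * 2^-1 < 1 by lra.
(* The contraction factors of [m], [v] and [w], in this order. *)
pose L := Num.max (Num.max (beta1 + (1 - beta1) * (mu / A))
                           (beta2 + (1 - beta2) * 2^-1)) (1 - Q / 8).
have L_gt0 : 0 < L by rewrite !lt_max orbC; apply/orP; left; lra.
have L_lt1 : L < 1.
  by rewrite !gt_max wm_lt1 wv_lt1/=; lra.
(* The crude growth factor of the position; being at least 1, it also covers both moments. *)
pose G := 1 + A * D.
have G_ge1 : 1 <= G by rewrite lerDl mulr_ge0// ltW.
have step n x : adam_dom x -> wmax_dist A wstar x <= rho ->
    wmax_dist A wstar (adam_step zeta eps alpha beta1 beta2 n x)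
      <= G * wmax_dist A wstar x /\
    ((n0 <= n)%N -> wmax_dist A wstar (adam_step zeta eps alpha beta1 beta2 n x)
      <= L * wmax_dist A wstar x).
  case: x => [[m v] w] xd; set M := wmax_dist A wstar (m, v, w) => M_rho.
  have M_ge0 : 0 <= M := wmax_dist_ge0 _ _ _.
  have /and3P[mM vM eM] : [&& enorm m <= M, enorm v <= M & A * enorm (w - wstar) <= M].
    by rewrite -(wmax_dist_le _ _ _ (m, v, w)).
  (* Here [1 <= A] lets the weighted norm control the plain distance to [wstar]. *)
  have e_M : enorm (w - wstar) <= M.
    by apply: le_trans eM; rewrite ler_peMl// enorm_ge0.
  have e_r : eball wstar r w by rewrite /eball /= (le_lt_trans e_M)// (le_lt_trans M_rho).
  have [zC _] := zeta_nearest w.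
  have z_le := clarke_grad_le grad_le e_r zC.
  have z_ge := clarke_grad_dotp_ge grad_ge e_r zC.
  have z2_le : enorm (zeta w) ^+ 2 <= 2^-1 * M.
    apply: (@le_trans _ _ ((mu * M) ^+ 2)).
      rewrite ler_sqr ?nnegrE ?enorm_ge0 ?mulr_ge0 ?(ltW mu_gt0)//.
      by apply: le_trans z_le _; rewrite ler_pM2l.
    rewrite (exprMn _ mu) (expr2 M) mulrA ler_wpM2r//; apply: le_trans rho_mu.
    by rewrite ler_pM2l ?exprn_gt0.
  rewrite !wmax_dist_le.
  (* One iteration from the current state has step index 0 instead of [n], but the update of [v] is
     the same for every index. *)
  have := adam_dom_adam zeta eps alpha beta1 1 beta2_ge0 (ltW beta2_lt1) xd.
  have := adam_step_wE zeta eps alpha beta1 beta2 n m v w wstar.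
  have m'_le := momentum_le delta_gt0 delta_le_mu mu_lt_A
    beta1_ge0 (ltW beta1_lt1) z_le mM eM.
  have v'_le := second_moment_le beta2_ge0 (ltW beta2_lt1) vM z2_le.
  rewrite /=.
  set m' := _ + _ in m'_le *; set v' := _ + _ in v'_le *.
  move=> posE x'd.
  have v'_ge0 i : 0 <= v' 0 i by exact: x'd.
  rewrite posE; split.
    apply/and3P; split.
    + apply: le_trans m'_le _; rewrite ler_wpM2r//; exact: ltW (lt_le_trans wm_lt1 G_ge1).
    + apply: le_trans v'_le _; rewrite ler_wpM2r//; exact: ltW (lt_le_trans wv_lt1 G_ge1).
    + apply: (position_crude_le delta_gt0 delta_le_mu mu_lt_A beta1_ge0
        (ltW beta1_lt1) D_ge0) => //.
      by move=> i; exact: precond_step_bounds.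
  move=> nn0; apply/and3P; split.
  + by apply: le_trans m'_le _; rewrite ler_wpM2r// !le_max lexx.
  + by apply: le_trans v'_le _; rewrite ler_wpM2r// !le_max lexx orbT.
  + apply: (@le_trans _ _ ((1 - Q / 8) * M)); last first.
      by rewrite ler_wpM2r// le_max lexx orbT.
    apply: (position_le delta_gt0 delta_le_mu mu_lt_A s_gt0 alpha_gt0
      beta1_ge0 alpha_le beta1E (ltW beta1_lt1) z_le z_ge mM eM).
    (* Each entry of the new second moment is at most [enorm v' <= M <= rho <= rho1]. *)
    move=> i; apply: step_near => //.
    apply: le_trans (ler_norm _) _; apply: le_trans (coord_le_enorm _ _) _.
    apply: le_trans v'_le _; apply: le_trans rho_rho1; apply: le_trans M_rho.
    by rewrite ler_piMl//; lra.
(* Dividing by [G ^+ n0] leaves room for the growth during the first [n0] steps. *)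
exists (@adam_dom R N `&` [set x | wmax_dist A wstar x <= rho / G ^+ n0]).
have Gn_gt0 : 0 < G ^+ n0 by rewrite exprn_gt0// (lt_le_trans ltr01).
split; first by move=> x [].
  have := @wmax_dist_nbhs R N A _ wstar (divr_gt0 rho_gt0 Gn_gt0).
  by apply: filterS => x xU xd; split.
exists n0, (G ^+ n0), L; split => // x0 [x0d x0_le].
have xd n := @adam_dom_adam _ _ zeta eps alpha beta1 beta2 _ n
  beta2_ge0 (ltW beta2_lt1) x0d.
apply: (eventual_contraction (rho := rho)
  (M := fun n => wmax_dist A wstar (adam zeta eps alpha beta1 beta2 x0 n))) => //.
- exact: ltW.
- exact: ltW.
- by move=> n; exact: wmax_dist_ge0.
- by move=> n Mn; exact: (step n _ (xd n) Mn).1.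
- by move=> n nn0 Mn; exact: (step n _ (xd n) Mn).2.
- by rewrite mulrC -ler_pdivlMr.
Qed.
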